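(* The following (i), (ii) hold. (i) The vector space $O$ has a basis consisting of the elements $$\mathcal W_{-k},\qquad \mathcal W_{k+1},\qquad (\tilde{\mathcal G}_{k+1}-\mathcal G_{k+1})/2\qquad (k\in\mathbb N).$$ (ii) The vector space $\mathcal Z$ has a basis consisting of the elements $$(\tilde{\mathcal G}_{k+1}+\mathcal G_{k+1})/2\qquad (k\in\mathbb N).$$
   Context: $\mathbb F$ is a field of characteristic zero; all vector spaces and Lie algebras are over $\mathbb F$. $\mathbb N=\{0,1,2,\ldots\}$. $\mathbb F[t,t^{-1}]$ is the algebra of Laurent polynomials. $L(\mathfrak{gl}_2)=\mathfrak{gl}_2\otimes\mathbb F[t,t^{-1}]$ is the loop algebra, with Lie bracket $[u\otimes\varphi,v\otimes\phi]=[u,v]\otimes\varphi\phi$; its elements are viewed as $2\times 2$ matrices with entries in $\mathbb F[t,t^{-1}]$, with bracket $[x,y]=xy-yx$. $L(\mathfrak{sl}_2)=\mathfrak{sl}_2\otimes\mathbb F[t,t^{-1}]$ is the Lie subalgebra of trace-zero matrices. For $x=\begin{pmatrix} a(t)&b(t)\\ c(t)&d(t)\end{pmatrix}\in L(\mathfrak{gl}_2)$ define $\theta(x)=\begin{pmatrix} d(t^{-1})&c(t^{-1})\\ b(t^{-1})&a(t^{-1})\end{pmatrix}$ and $\varepsilon(x)=a(1)+d(1)\in\mathbb F$. Then $\theta$ is a Lie algebra automorphism of $L(\mathfrak{gl}_2)$ and $\varepsilon:L(\mathfrak{gl}_2)\to\mathbb F$ is a Lie algebra homomorphism ($\mathbb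 F$ abelian). Let $\mathcal L=\ker\varepsilon$. Let $O$ be the Lie algebra of all elements of $L(\mathfrak{sl}_2)$ fixed by $\theta$ (the Onsager Lie algebra), and let $\mathcal O$ be the Lie algebra of all elements of $\mathcal L$ fixed by $\theta$. Thus $O\subseteq\mathcal O$. Let $\mathcal Z$ be the center of $\mathcal O$. For $k\in\mathbb N$ define \begin{align*} &\mathcal W_{-k}=\Bigl(\tfrac{t+t^{-1}}{2}\Bigr)^k\begin{pmatrix}0&1\\1&0\end{pmatrix},\qquad \mathcal W_{k+1}=\Bigl(\tfrac{t+t^{-1}}{2}\Bigr)^k\begin{pmatrix}0&t\\t^{-1}&0\end{pmatrix},\\ &\mathcal G_{k+1}=\Bigl(\tfrac{t+t^{-1}}{2}\Bigr)^k\begin{pmatrix}2t-2&0\\0&2t^{-1}-2\end{pmatrix},\qquad \tilde{\mathcal G}_{k+1}=\Bigl(\tfrac{t+t^{-1}}{2}\Bigr)^k\begin{pmatrix}2t^{-1}-2&0\\0&2t-2\end{pmatrix}. \end{align*} *)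

(* Defs.v *)
From HB Require Import structures.
From mathcomp Require Import all_boot all_order all_algebra finmap ring.
From mathcomp.multinomials Require Import monalg.

Set Implicit Arguments.
Unset Strict Implicit.
Unset Printing Implicit Defensive.

Import GRing.Theory.

Local Open Scope fset_scope.
Local Open Scope ring_scope.

(* Laurent polynomials F[t, t^-1] are the finitely supported functions       *)
(* int -> F, with f@_n the coefficient of t^n and the convolution product.   *)
(* [monalg] gives {malg F[K]} a product only when the monoid K has no        *)
(* nontrivial units, so for K = int the product is defined here. Scaling and *)
(* product are locked because unification otherwise unfolds them to sums.    *)
Definition laurent (F : fieldType) : Type := {malg F[int]}.

HB.instance Definition _ (F : fieldType) :=
  GRing.Zmodule.copy (laurent F) {malg F[int]}.

Bind Scope ring_scope with laurent.

Definition tpow (F : fieldType) (n : int) : laurent F := mkmalgU n (1 : F).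

HB.lock Definition lscale (F : fieldType) (a : F) (f : laurent F) : laurent F :=
  (a *: (f : {malg F[int]})).

Lemma lcoefZ_def (F : fieldType) (a : F) (f : laurent F) (n : int) :
  (lscale a f)@_n = a * f@_n.
Proof. by rewrite lscale.unlock mcoeffZ. Qed.

Section LaurentModule.
Variable F : fieldType.

Fact lscaleA (a b : F) (f : laurent F) :
  lscale a (lscale b f) = lscale (a * b) f.
Proof. by apply/malgP => n; rewrite !lcoefZ_def mulrA. Qed.

Fact lscale1 : left_id 1 (@lscale F).
Proof. by move=> f; apply/malgP => n; rewrite lcoefZ_def mul1r. Qed.

Fact lscaleDr : right_distributive (@lscale F) +%R.
Proof.
by move=> a f g; apply/malgP => n; rewrite !(lcoefZ_def, mcoeffD) mulrDr.
Qed.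

Fact lscaleDl (f : laurent F) : {morph (@lscale F)^~ f : a b / a + b}.
Proof.
by move=> a b; apply/malgP => n; rewrite !(lcoefZ_def, mcoeffD) mulrDl.
Qed.

HB.instance Definition _ := GRing.Zmodule_isLmodule.Build F (laurent F)
  lscaleA lscale1 lscaleDr lscaleDl.

Lemma lcoefZ (a : F) (f : laurent F) (n : int) : (a *: f)@_n = a * f@_n.
Proof. exact: lcoefZ_def. Qed.

Lemma lsuppZ_le (a : F) (f : laurent F) : msupp (a *: f) `<=` msupp f.
Proof.
apply/fsubsetP => n; rewrite -!mcoeff_neq0 lcoefZ.
by apply: contra => /eqP ->; rewrite mulr0.
Qed.

End LaurentModule.

HB.lock Definition lmul (F : fieldType) (f g : laurent F) : laurent F :=
  \sum_(i <- msupp f) \sum_(j <- msupp g)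
    (mkmalgU (i + j)%R (f@_i * g@_j) : laurent F).

Section LaurentRing.
Variable F : fieldType.
Implicit Types (f g h : laurent F) (n : int) (a b : F).

Definition lone : laurent F := tpow F 0.

Let U n a : laurent F := mkmalgU n a.

Let monalgU0' n : U n 0 = 0. Proof. exact: monalgU0. Qed.

Let monalgUD' n a b : U n (a + b) = U n a + U n b.
Proof. exact: monalgUD. Qed.

Lemma laurentP f g : (forall n : int, f@_n = g@_n) -> f = g.
Proof. by move=> fg; apply/malgP. Qed.

Lemma laurentE f : f = \sum_(n <- msupp f) (mkmalgU n f@_n : laurent F).
Proof. exact: monalgE. Qed.

Lemma lmulE (d1 d2 : {fset int}) f g : msupp f `<=` d1 -> msupp g `<=` d2 ->
  lmul f g = \sum_(i <- d1) \sum_(j <- d2) U (i + j)%R (f@_i * g@_j).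
Proof.
move=> le1 le2; rewrite lmul.unlock (big_fset_incl _ le1) /=; last first.
  by move=> i _ /mcoeff_outdom fi; rewrite big1 // => j _;
     rewrite fi mul0r monalgU0.
apply: eq_bigr => i _; apply: big_fset_incl => // j _ /mcoeff_outdom ->.
by rewrite mulr0 monalgU0.
Qed.

Lemma lmulC : commutative (@lmul F).
Proof.
move=> f g; rewrite lmul.unlock exchange_big /=; apply: eq_bigr => j _.
by apply: eq_bigr => i _; rewrite addrC mulrC.
Qed.

Lemma lmulDl : left_distributive (@lmul F) +%R.
Proof.
move=> f g h.
rewrite (lmulE (msuppD_le f g) (fsubset_refl _)).
rewrite (lmulE (fsubsetUl _ (msupp g)) (fsubset_refl (msupp h))).
rewrite (lmulE (fsubsetUr (msupp f) _) (fsubset_refl (msupp h))).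
rewrite -big_split /=; apply: eq_bigr => i _.
rewrite -big_split /=; apply: eq_bigr => j _.
by rewrite mcoeffD mulrDl monalgUD'.
Qed.

Lemma lmul0 : left_zero 0 (@lmul F).
Proof. by move=> f; rewrite lmul.unlock msupp0 big_seq_fset0. Qed.

Lemma lmulUU m n a b : lmul (U m a) (U n b) = U (m + n) (a * b).
Proof.
by rewrite (lmulE msuppU_le msuppU_le) !big_seq_fset1 /U !mcoeffUU.
Qed.

Lemma lmul_suml (I : Type) (s : seq I) (p : I -> laurent F) g :
  lmul (\sum_(i <- s) p i) g = \sum_(i <- s) lmul (p i) g.
Proof.
exact: (big_morph _ (fun f1 f2 => lmulDl f1 f2 g) (lmul0 g)).
Qed.

Lemma lmul_sumr (I : Type) (s : seq I) (p : I -> laurent F) g :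
  lmul g (\sum_(i <- s) p i) = \sum_(i <- s) lmul g (p i).
Proof. by rewrite lmulC lmul_suml; apply: eq_bigr => i _; rewrite lmulC. Qed.

Lemma lmulA : associative (@lmul F).
Proof.
move=> f g h; rewrite (laurentE f) !lmul_suml; apply: eq_bigr => i _.
rewrite (laurentE g) !(lmul_suml, lmul_sumr); apply: eq_bigr => j _.
rewrite (laurentE h) !lmul_sumr; apply: eq_bigr => k _.
by rewrite !lmulUU mulrA addrA.
Qed.

Lemma lmulZ a f : lmul (U 0 a) f = a *: f.
Proof.
rewrite [in LHS](laurentE f) lmul_sumr.
rewrite [RHS]/GRing.scale /= lscale.unlock malgZ_def.
by apply: eq_bigr => n _; rewrite lmulUU add0r.
Qed.

Lemma lmul1 : left_id lone (@lmul F).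
Proof.
move=> f; rewrite {1}(laurentE f) lmul_sumr [RHS]laurentE.
by apply: eq_bigr => i _; rewrite [LHS]lmulUU add0r mul1r.
Qed.

Lemma lone_neq0 : lone != 0.
Proof.
by apply/eqP => /(congr1 (mcoeff (0 : int))) /eqP;
   rewrite mcoeffUU mcoeff0 oner_eq0.
Qed.

HB.instance Definition _ := GRing.Zmodule_isComNzRing.Build (laurent F)
  lmulA lmulC lmul1 lmulDl lone_neq0.

Lemma lscaleAl a f g : a *: (f * g) = (a *: f) * g.
Proof.
by rewrite -!lmulZ; exact: lmulA.
Qed.

HB.instance Definition _ :=
  GRing.Lmodule_isLalgebra.Build F (laurent F) lscaleAl.
HB.instance Definition _ := GRing.Lalgebra_isComAlgebra.Build F (laurent F).

End LaurentRing.

Section LaurentMaps.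
Variable F : fieldType.
Implicit Types (f g : laurent F) (n : int) (a : F).

Lemma tpowD m n : tpow F m * tpow F n = tpow F (m + n).
Proof. by rewrite [LHS]lmulUU mulr1. Qed.

Lemma tpow0 : tpow F 0 = 1.
Proof. by []. Qed.

Lemma laurent_tpowE f : f = \sum_(n <- msupp f) f@_n *: tpow F n.
Proof.
rewrite {1}(laurentE f); apply: eq_bigr => n _.
by apply: laurentP => m; rewrite lcoefZ !mcoeffU mulrnAr mulr1.
Qed.

(* f(t^-1) and f(1). *)
Definition linv f : laurent F := \sum_(n <- msupp f) f@_n *: tpow F (- n).

Definition lev1 f : F := \sum_(n <- msupp f) f@_n.

Lemma linvE (d : {fset int}) f : msupp f `<=` d ->
  linv f = \sum_(n <- d) f@_n *: tpow F (- n).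
Proof.
by move=> le; apply: big_fset_incl => // n _ /mcoeff_outdom ->; rewrite scale0r.
Qed.

Lemma lev1E (d : {fset int}) f : msupp f `<=` d -> lev1 f = \sum_(n <- d) f@_n.
Proof. by move=> le; apply: big_fset_incl => // n _ /mcoeff_outdom ->. Qed.

Lemma linv_linear : linear linv.
Proof.
move=> a f g; set d := msupp f `|` msupp g.
have led : msupp (a *: f + g) `<=` d.
  by apply: (fsubset_trans (msuppD_le _ _)); apply: fsetSU; apply: lsuppZ_le.
rewrite (linvE led) (linvE (fsubsetUl (msupp f) (msupp g))).
rewrite (linvE (fsubsetUr (msupp f) (msupp g))) scaler_sumr -big_split /=.
by apply: eq_bigr => n _; rewrite mcoeffD lcoefZ scalerDl scalerA.
Qed.

HB.instance Definition _ :=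
  GRing.isLinear.Build F (laurent F) (laurent F) _ linv linv_linear.

Lemma lev1_linear : linear_for *%R lev1.
Proof.
move=> a f g; set d := msupp f `|` msupp g.
have led : msupp (a *: f + g) `<=` d.
  by apply: (fsubset_trans (msuppD_le _ _)); apply: fsetSU; apply: lsuppZ_le.
rewrite (lev1E led) (lev1E (fsubsetUl (msupp f) (msupp g))).
rewrite (lev1E (fsubsetUr (msupp f) (msupp g))) mulr_sumr -big_split /=.
by apply: eq_bigr => n _; rewrite mcoeffD lcoefZ.
Qed.

HB.instance Definition _ :=
  GRing.isLinear.Build F (laurent F) F _ lev1 lev1_linear.

Lemma linv_tpow n : linv (tpow F n) = tpow F (- n).
Proof. by rewrite (linvE msuppU_le) big_seq_fset1 mcoeffUU scale1r. Qed.

Lemma lev1_tpow n : lev1 (tpow F n) = 1.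
Proof. by rewrite (lev1E msuppU_le) big_seq_fset1 mcoeffUU. Qed.

Lemma linv_monoid_morphism : monoid_morphism linv.
Proof.
split=> [|f g]; first by rewrite -tpow0 linv_tpow oppr0.
rewrite (laurent_tpowE f) (laurent_tpowE g).
rewrite mulr_suml !linear_sum mulr_suml /=; apply: eq_bigr => i _.
rewrite mulr_sumr !linear_sum mulr_sumr /=; apply: eq_bigr => j _.
rewrite -!scalerAl -!scalerAr !linearZ /= -scalerAl -scalerAr.
by rewrite !tpowD !linv_tpow tpowD opprD.
Qed.

HB.instance Definition _ :=
  GRing.isMonoidMorphism.Build (laurent F) (laurent F) linv
    linv_monoid_morphism.

Lemma lev1_monoid_morphism : monoid_morphism lev1.
Proof.
split=> [|f g]; first by rewrite -tpow0 lev1_tpow.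
rewrite (laurent_tpowE f) (laurent_tpowE g).
rewrite mulr_suml !linear_sum mulr_suml /=; apply: eq_bigr => i _.
rewrite mulr_sumr !linear_sum mulr_sumr /=; apply: eq_bigr => j _.
by rewrite -!scalerAl -!scalerAr !linearZ /= tpowD !lev1_tpow !mulr1.
Qed.

HB.instance Definition _ :=
  GRing.isMonoidMorphism.Build (laurent F) F lev1 lev1_monoid_morphism.

Lemma linvK : involutive linv.
Proof.
have LK (L : {linear laurent F -> laurent F}) :
    (forall n, L (tpow F n) = tpow F (- n)) -> involutive L.
  move=> Lt f; rewrite [f]laurent_tpowE !linear_sum.
  by apply: eq_bigr => n _; rewrite !linearZ /= !Lt opprK.
exact: (LK _ linv_tpow).
Qed.

End LaurentMaps.

(* A copy of 'M[laurent F]_2 carrying scalar multiplication by F (the library *)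
(* instance on matrices scales by laurent F instead).                         *)
Definition loop_gl2 (F : fieldType) : Type := 'M[laurent F]_2.

HB.instance Definition _ (F : fieldType) :=
  GRing.NzRing.copy (loop_gl2 F) 'M[laurent F]_2.

Bind Scope ring_scope with loop_gl2.

Section LoopAlgebra.
Variable F : fieldType.
Implicit Types (x y z : loop_gl2 F) (a b : F).

Definition loop_scale a x : loop_gl2 F := \matrix_(i, j) (a *: x i j).

Fact loop_scaleA a b x : loop_scale a (loop_scale b x) = loop_scale (a * b) x.
Proof. by apply/matrixP => i j; rewrite !mxE scalerA. Qed.

Fact loop_scale1 : left_id 1 loop_scale.
Proof. by move=> x; apply/matrixP => i j; rewrite !mxE scale1r. Qed.

Fact loop_scaleDr : right_distributive loop_scale +%R.
Proof. by move=> a x y; apply/matrixP => i j; rewrite !mxE scalerDr. Qed.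

Fact loop_scaleDl x : {morph loop_scale^~ x : a b / a + b}.
Proof. by move=> a b; apply/matrixP => i j; rewrite !mxE scalerDl. Qed.

HB.instance Definition _ := GRing.Zmodule_isLmodule.Build F (loop_gl2 F)
  loop_scaleA loop_scale1 loop_scaleDr loop_scaleDl.

Fact loop_scaleAl a x y : a *: (x * y) = (a *: x) * y.
Proof.
apply/matrixP => i j; rewrite !mxE scaler_sumr.
by apply: eq_bigr => k _; rewrite mxE scalerAl.
Qed.

Fact loop_scaleAr a x y : a *: (x * y) = x * (a *: y).
Proof.
apply/matrixP => i j; rewrite !mxE scaler_sumr.
by apply: eq_bigr => k _; rewrite mxE scalerAr.
Qed.

HB.instance Definition _ :=
  GRing.Lmodule_isLalgebra.Build F (loop_gl2 F) loop_scaleAl.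
HB.instance Definition _ :=
  GRing.Lalgebra_isAlgebra.Build F (loop_gl2 F) loop_scaleAr.

Definition mat2 (p q r s : laurent F) : loop_gl2 F :=
  \matrix_(i, j) if i == 0 then if j == 0 then p else q
                 else if j == 0 then r else s.

Lemma mat2E p q r s :
  (mat2 p q r s 0 0 = p) * (mat2 p q r s 0 1 = q) *
  (mat2 p q r s 1 0 = r) * (mat2 p q r s 1 1 = s).
Proof. by rewrite !mxE. Qed.

Lemma loopP x y :
  x 0 0 = y 0 0 -> x 0 1 = y 0 1 -> x 1 0 = y 1 0 -> x 1 1 = y 1 1 -> x = y.
Proof.
move=> e00 e01 e10 e11; apply/matrixP => i j.
have o2 (k : 'I_2) : k = 0 \/ k = 1.
  by case: k => [[|[|//]] lt]; [left | right]; apply: val_inj.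
by case: (o2 i) => ->; case: (o2 j) => ->.
Qed.

Lemma loop_mulE x y (i j : 'I_2) :
  (x * y) i j = x i 0 * y 0 j + x i 1 * y 1 j.
Proof.
have -> : (1 : 'I_2) = lift ord0 ord0 by apply: val_inj.
by rewrite mxE big_ord_recl big_ord1.
Qed.

Definition bracket x y : loop_gl2 F := x * y - y * x.

Definition theta x : loop_gl2 F :=
  mat2 (linv (x 1 1)) (linv (x 1 0)) (linv (x 0 1)) (linv (x 0 0)).

Definition epsilon x : F := lev1 (x 0 0) + lev1 (x 1 1).

Lemma theta_linear : linear theta.
Proof.
by move=> a x y; apply: loopP; rewrite !mxE /= linearP.
Qed.

HB.instance Definition _ :=
  GRing.isLinear.Build F (loop_gl2 F) (loop_gl2 F) _ theta theta_linear.

Lemma epsilon_linear : linear_for *%R epsilon.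
Proof.
by move=> a x y; rewrite /epsilon !mxE !linearP /= mulrDr addrACA.
Qed.

HB.instance Definition _ :=
  GRing.isLinear.Build F (loop_gl2 F) F _ epsilon epsilon_linear.

Lemma thetaK : involutive theta.
Proof. by move=> x; apply: loopP; rewrite !mxE /= linvK. Qed.

Lemma thetaM x y : theta (x * y) = theta x * theta y.
Proof.
by apply: loopP; rewrite [RHS]loop_mulE !mat2E loop_mulE rmorphD !rmorphM;
   rewrite /= addrC.
Qed.

Lemma theta_bracket x y : theta (bracket x y) = bracket (theta x) (theta y).
Proof. by rewrite /bracket linearB /= !thetaM. Qed.

Lemma epsilon_bracket x y : epsilon (bracket x y) = 0.
Proof.
rewrite /bracket linearB /= /epsilon !loop_mulE !rmorphD !rmorphM /=.
ring.
Qed.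

Definition loop_sl2 x : Prop := \tr x = 0.

Definition ker_epsilon x : Prop := epsilon x = 0.

Definition onsager x : Prop := loop_sl2 x /\ theta x = x.

Definition cal_onsager x : Prop := ker_epsilon x /\ theta x = x.

Definition center_cal_onsager x : Prop :=
  cal_onsager x /\ forall y, cal_onsager y -> bracket x y = 0.

Lemma loop_trE x : \tr x = x 0 0 + x 1 1.
Proof.
rewrite /mxtrace big_ord_recl big_ord1.
by congr (_ + x _ _); apply: val_inj.
Qed.

Lemma onsager_sub x : onsager x -> cal_onsager x.
Proof.
by case=> trx thx; split=> //; rewrite /ker_epsilon /epsilon -rmorphD /=
   -loop_trE [\tr x]trx rmorph0.
Qed.

Lemma onsager_linear a x y : onsager x -> onsager y -> onsager (a *: x + y).
Proof.
case=> trx thx [try thy]; split; last by rewrite linearP /= thx thy.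
move: trx try; rewrite /loop_sl2 !loop_trE !mxE addrACA -scalerDr => -> ->.
by rewrite scaler0 addr0.
Qed.

Lemma onsager_bracket x y : onsager x -> onsager y -> onsager (bracket x y).
Proof.
case=> _ thx [_ thy]; split; last by rewrite theta_bracket thx thy.
by rewrite /loop_sl2 /bracket (linearB (@mxtrace _ 2)) /= mxtrace_mulC subrr.
Qed.

Lemma cal_onsager_linear a x y :
  cal_onsager x -> cal_onsager y -> cal_onsager (a *: x + y).
Proof.
case=> ex thx [ey thy]; split; last by rewrite linearP /= thx thy.
by rewrite /ker_epsilon linearP /= [epsilon x]ex [epsilon y]ey mulr0 addr0.
Qed.

Lemma cal_onsager_bracket x y :
  cal_onsager x -> cal_onsager y -> cal_onsager (bracket x y).
Proof.
case=> _ thx [_ thy]; split; last by rewrite theta_bracket thx thy.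
exact: epsilon_bracket.
Qed.

Lemma center_cal_onsager_linear a x y : center_cal_onsager x ->
  center_cal_onsager y -> center_cal_onsager (a *: x + y).
Proof.
case=> ox cx [oy cy]; split=> [|z oz]; first exact: cal_onsager_linear.
have -> : bracket (a *: x + y) z = a *: bracket x z + bracket y z.
  rewrite /bracket mulrDl mulrDr -scalerAl -scalerAr scalerBr opprD.
  by rewrite addrACA.
by rewrite cx // cy // scaler0 addr0.
Qed.

Definition tavg : laurent F := 2^-1 *: (tpow F 1 + tpow F (-1)).

Definition avg_pow (k : nat) x : loop_gl2 F :=
  \matrix_(i, j) (tavg ^+ k * x i j).

(* Indices are shifted so that every family is indexed by k : nat:           *)
(* W_neg k = W_{-k}, W_succ k = W_{k+1}, G_succ k = G_{k+1} and              *)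
(* Gt_succ k = tilde G_{k+1}.                                                 *)
Definition W_neg (k : nat) : loop_gl2 F := avg_pow k (mat2 0 1 1 0).

Definition W_succ (k : nat) : loop_gl2 F :=
  avg_pow k (mat2 0 (tpow F 1) (tpow F (-1)) 0).

Definition G_succ (k : nat) : loop_gl2 F :=
  avg_pow k (mat2 (2 * tpow F 1 - 2) 0 0 (2 * tpow F (-1) - 2)).

Definition Gt_succ (k : nat) : loop_gl2 F :=
  avg_pow k (mat2 (2 * tpow F (-1) - 2) 0 0 (2 * tpow F 1 - 2)).

Definition onsager_family (i : nat + nat + nat) : loop_gl2 F :=
  match i with
  | inl (inl k) => W_neg k
  | inl (inr k) => W_succ k
  | inr k => 2^-1 *: (Gt_succ k - G_succ k)
  end.

Definition center_family (k : nat) : loop_gl2 F :=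
  2^-1 *: (Gt_succ k + G_succ k).

End LoopAlgebra.

Section Basis.
Variables (F : fieldType) (V : lmodType F) (I : eqType).

Definition lin_indep (v : I -> V) : Prop :=
  forall (s : seq I) (c : I -> F), uniq s ->
    \sum_(i <- s) c i *: v i = 0 -> forall i, i \in s -> c i = 0.

Definition in_span (v : I -> V) (x : V) : Prop :=
  exists (s : seq I) (c : I -> F), x = \sum_(i <- s) c i *: v i.

Definition is_basis (S : V -> Prop) (v : I -> V) : Prop :=
  lin_indep v /\ (forall x, S x <-> in_span v x).

End Basis.

(* Main.v *)
From HB Require Import structures.
Require Import Defs.
From mathcomp Require Import all_boot all_algebra finmap ring.
From mathcomp.multinomials Require Import monalg.

(** Put s = (t + t^-1)/2. Since t^2 = 2 s t - 1 and t^-1 = 2 s - t, the Laurent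
    polynomials are spanned by 1 and t over F[s] ([laurent_decomp]). They are
    even free over F[s] with this basis ([laurent_free]): looking at the
    coefficient of the highest power of t shows that P(s) = 0 forces P = 0, and
    P(s) + Q(s) t = 0 is separated by the involution t -> t^-1, which fixes s
    and yields Q(s) (t - t^-1) = 0, where t - t^-1 is cancelled because its
    square 4 (s^2 - 1) is a nonzero element of F[s].

    In these coordinates everything is linear algebra over F[s]. An element of
    the Onsager algebra is determined by its first row (a, b), where b is
    arbitrary and a changes sign under t -> t^-1; so b = P(s) + Q(s) t and
    a = S(s) (t^-1 - t), with unique polynomials P, Q, S ([onsagerP],
    [onsager_map_inj]).

    A central element has to commute with W_0 and W_1, which already forces it to
    be scalar, x = a I, with a invariant under t -> t^-1, i.e. a = P(s). The
    condition epsilon(x) = 0 becomes P(1) = 0, so that a = R(s) (2 s - 2) for a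
    unique R ([centerP]), and (2 s - 2) I is the first member of the family.

    In both cases the family is thus the image of monomials 'X^k under an
    injective linear map from a space of tuples of polynomials onto the space in
    question, which is what [is_basis_image] needs. *)

Set Implicit Arguments.
Unset Strict Implicit.
Unset Printing Implicit Defensive.

Import GRing.Theory.
Local Open Scope ring_scope.

(** * Bases *)

Section Bases.
Variable F : fieldType.

Lemma is_basis_image (U V : lmodType F) (I : eqType) (e : I -> U)
    (phi : {linear U -> V}) (S : V -> Prop) (v : I -> V) :
    is_basis (fun=> True) e -> (forall u, phi u = 0 -> u = 0) ->
    (forall x, S x <-> exists u, x = phi u) -> (forall i, v i = phi (e i)) ->
  is_basis S v.
Proof.
move=> [free_e span_e] phi_inj imS vE.
have phi_sum (s : seq I) (c : I -> F) :
    \sum_(i <- s) c i *: v i = phi (\sum_(i <- s) c i *: e i).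
  by rewrite linear_sum; apply: eq_bigr => i _; rewrite linearZ vE.
split=> [s c uniq_s|x].
  by rewrite phi_sum => /phi_inj; apply: free_e.
split=> [/imS[u ->]|[s [c ->]]].
  have [s [c ->]] := (span_e u).1 Logic.I.
  by exists s, c; rewrite phi_sum.
by apply/imS; exists (\sum_(i <- s) c i *: e i); rewrite phi_sum.
Qed.

Lemma is_basis_monomials : is_basis (fun=> True) (fun k => 'X^k : {poly F}).
Proof.
split=> [s c uniq_s sum0 k ks|P].
  have := congr1 (coefp k) sum0; rewrite linear_sum /= coef0 (bigD1_seq k) //=.
  rewrite coefZ coefXn eqxx mulr1 big1 ?addr0 // => i ik.
  by rewrite coefZ coefXn eq_sym (negPf ik) mulr0.
split=> // _; exists (iota 0 (size P)), (fun k => P`_k).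
by rewrite -{1}[P]coefK poly_def -(big_mkord predT (fun k => P`_k *: 'X^k))
  /index_iota subn0.
Qed.

Definition pair_family (U V : lmodType F) (I J : eqType) (e : I -> U)
    (f : J -> V) (k : I + J) : U * V :=
  match k with inl i => (e i, 0) | inr j => (0, f j) end.

Lemma is_basis_pair (U V : lmodType F) (I J : eqType) (e : I -> U)
    (f : J -> V) :
    is_basis (fun=> True) e -> is_basis (fun=> True) f ->
  is_basis (fun=> True) (pair_family e f).
Proof.
move=> [free_e span_e] [free_f span_f].
split=> [s c uniq_s sum0|[x y]].
  (* The components of the vanishing sum are sums over the two halves of s;
     taking them with pmap keeps the index lists duplicate-free. *)
  pose left (k : (I + J)%type) : option I :=
    if k is inl i then Some i else None : option I.
  pose right (k : (I + J)%type) : option J :=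
    if k is inr j then Some j else None : option J.
  have leftK : ocancel left (@inl I J) by case.
  have rightK : ocancel right (@inr I J) by case.
  have c_inl i : i \in pmap left s -> c (inl i) = 0.
    apply: (free_e _ (fun i => c (inl i)) (pmap_uniq leftK uniq_s)).
    rewrite big_pmap -[RHS](congr1 fst sum0) linear_sum.
    by apply: eq_bigr => [[j|j]] _ //=; rewrite scaler0.
  have c_inr j : j \in pmap right s -> c (inr j) = 0.
    apply: (free_f _ (fun j => c (inr j)) (pmap_uniq rightK uniq_s)).
    rewrite big_pmap -[RHS](congr1 snd sum0) linear_sum.
    by apply: eq_bigr => [[i|i]] _ //=; rewrite scaler0.
  by case=> [i|j] ks; [apply: c_inl | apply: c_inr];
    rewrite mem_pmap; apply/mapP; eexists; eauto.
split=> // _.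
have [s [c ->]] := (span_e x).1 Logic.I.
have [s' [c' ->]] := (span_f y).1 Logic.I.
exists ([seq inl i | i <- s] ++ [seq inr j | j <- s']).
exists (fun k => match k with inl i => c i | inr j => c' j end).
rewrite big_cat !big_map /=.
have pairP (p q : U * V) : p.1 = q.1 -> p.2 = q.2 -> p = q.
  by case: p q => [? ?] [? ?] /= -> ->.
apply: pairP; rewrite [RHS]linearD !linear_sum /=.
  by rewrite [X in _ + X]big1 ?addr0 // => j _; rewrite scaler0.
by rewrite [X in X + _]big1 ?add0r // => i _; rewrite scaler0.
Qed.

End Bases.

(** * Laurent polynomials as a free module over F[s] *)

Section Laurent.
Variable F : fieldType.

Local Notation t := (tpow F 1).
Local Notation tV := (tpow F (-1)).
Local Notation s := (tavg F).
Local Notation "P .[s]" := (horner_alg (tavg F) P)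
  (at level 2, left associativity, format "P .[s]").

Lemma tpow_tV : t * tV = 1.
Proof. by rewrite tpowD subrr tpow0. Qed.

Lemma linv_tavg : linv s = s.
Proof. by rewrite /tavg linearZ /= raddfD /= !linv_tpow opprK addrC. Qed.

Lemma linv_horner (P : {poly F}) : linv P.[s] = P.[s].
Proof.
elim/poly_ind: P => [|P a IH]; first by rewrite !raddf0.
rewrite !rmorphD !rmorphM /= horner_algX horner_algC linv_tavg IH.
by rewrite linearZ /= rmorph1.
Qed.

Lemma mcoeff_tpowM (n m : int) (f : laurent F) :
  mcoeff n (tpow F m * f) = mcoeff (n - m) f.
Proof.
have -> : f = \sum_(k <- msupp f) mcoeff k f *: tpow F k by exact: laurent_tpowE.
rewrite mulr_sumr !raddf_sum; apply: eq_bigr => k _ /=.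
rewrite -scalerAr tpowD !lcoefZ !mcoeffU; congr (_ * (_ *+ (_ : bool))).
by rewrite [RHS]eq_sym subr_eq addrC eq_sym.
Qed.

Lemma mcoeff_tavgM (n : int) (f : laurent F) :
  mcoeff n (s * f) = 2^-1 * (mcoeff (n - 1) f + mcoeff (n + 1) f).
Proof.
by rewrite /tavg -scalerAl lcoefZ mulrDl mcoeffD !mcoeff_tpowM opprK.
Qed.

(** s^k is a combination of t^-k, ..., t^k with top coefficient 2^-k. *)
Lemma mcoeff_tavgX (k n : nat) : (k <= n)%N ->
  mcoeff (n%:Z) (s ^+ k) = (2^-1) ^+ k *+ (n == k).
Proof.
elim: k n => [|k IH] n; first by rewrite expr0 -tpow0 mcoeffU eq_sym expr0.
case: n => // n; rewrite ltnS => kn; rewrite exprS mcoeff_tavgM.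
have -> : n.+1%:Z - 1 = n%:Z by rewrite -addn1 PoszD addrK.
have -> : n.+1%:Z + 1 = n.+2%:Z by rewrite -addn1 -[in RHS]addn1 PoszD.
rewrite !IH //; last by apply: leq_trans kn _; rewrite -addn2 leq_addr.
have /gtn_eqF-> : (k < n.+2)%N by rewrite ltnS (leq_trans kn).
by rewrite addr0 eqSS exprS mulrnAr.
Qed.

Hypothesis two_neq0 : (2 : F) != 0.

Lemma mul2_half (f : laurent F) : 2 * (2^-1 *: f) = f.
Proof. by rewrite mulr_natl -scaler_nat scalerA mulfV // scale1r. Qed.

Lemma half_eq (f g : laurent F) : f = 2 * g -> 2^-1 *: f = g.
Proof. by move->; rewrite mulr_natl -scaler_nat scalerA mulVf // scale1r. Qed.

Lemma tpow_tavg : t + tV = 2 * s.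
Proof. by rewrite /tavg mul2_half. Qed.

Lemma tVE : tV = 2 * s - t.
Proof. by rewrite -tpow_tavg addrAC subrr add0r. Qed.

Lemma tpow_sqr : t * t = 2 * s * t - 1.
Proof. by rewrite -tpow_tavg -tpow_tV; ring. Qed.

(** P(s) has coefficient lead_coef P / 2^(deg P) at t^(deg P). *)
Lemma horner_tavg_inj (P : {poly F}) : P.[s] = 0 -> P = 0.
Proof.
move=> Ps0; apply/eqP; apply: contraTT isT => P_neq0.
have := congr1 (mcoeff ((size P).-1)%:Z) Ps0.
have -> : P.[s] = \sum_(i < size P) P`_i *: s ^+ i.
  rewrite -{1}[P]coefK poly_def linear_sum; apply: eq_bigr => i _.
  by rewrite linearZ /= rmorphXn /= horner_algX mulr_algl.
have := P_neq0; rewrite -size_poly_gt0; case szP: (size P) => [//|n] _ /=.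
rewrite raddf_sum /= mcoeff0 big_ord_recr /= lcoefZ mcoeff_tavgX // eqxx.
rewrite big1 ?add0r => [/eqP|i _]; last first.
  have lt_in := ltn_ord i.
  by rewrite lcoefZ (mcoeff_tavgX (ltnW lt_in)) (gtn_eqF lt_in) mulr0.
rewrite mulf_eq0 expf_eq0 invr_eq0 (negPf two_neq0) andbF orbF.
have -> : P`_n = lead_coef P by rewrite lead_coefE szP.
by rewrite lead_coef_eq0 (negPf P_neq0).
Qed.

Lemma tpowB_sqr : (t - tV) ^+ 2 = (4%:R * ('X^2 - 1)).[s].
Proof.
rewrite rmorphM rmorph_nat rmorphB rmorphXn rmorph1 /= horner_algX tVE.
ring: tpow_sqr.
Qed.

Lemma tpowB_sqr_neq0 : 4%:R * ('X^2 - 1) != 0 :> {poly F}.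
Proof.
rewrite mulf_neq0 //; last by rewrite -size_poly_eq0 size_Xn_sub_1.
by rewrite -polyC_natr polyC_eq0 (natrM _ 2 2) mulf_neq0.
Qed.

(** The involution t -> t^-1 gives P(s) + Q(s) t^-1 = 0 as well, and the
    difference of the two relations is Q(s) (t - t^-1) = 0. Multiplying it by
    t - t^-1 produces a relation in F[s] alone. *)
Lemma laurent_free (P Q : {poly F}) :
  P.[s] + Q.[s] * t = 0 -> P = 0 /\ Q = 0.
Proof.
move=> PQ0; have := congr1 (@linv F) PQ0.
rewrite rmorphD rmorphM /= !linv_horner linv_tpow rmorph0 => PQV0.
have Q0 : Q = 0.
  apply: (mulfI tpowB_sqr_neq0); rewrite mulr0; apply: horner_tavg_inj.
  rewrite rmorphM /= -tpowB_sqr.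
  have -> : (t - tV) ^+ 2 * Q.[s] =
    (t - tV) * ((P.[s] + Q.[s] * t) - (P.[s] + Q.[s] * tV)) by ring.
  by rewrite PQ0 PQV0 subrr mulr0.
split=> //; apply: horner_tavg_inj.
by move: PQ0; rewrite Q0 rmorph0 mul0r addr0.
Qed.

(** F[s] + F[s] t contains 1 and is stable under t and t^-1, as t^2 = 2 s t - 1
    and t^-1 = 2 s - t. *)
Lemma laurent_decomp (f : laurent F) : exists P Q, f = P.[s] + Q.[s] * t.
Proof.
pose M (g : laurent F) := exists P Q, g = P.[s] + Q.[s] * t.
have Mt g : M g -> M (t * g).
  move=> [P [Q ->]]; exists (- Q), (P + 2%:R * 'X * Q).
  rewrite rmorphN rmorphD !rmorphM rmorph_nat /= horner_algX; ring: tpow_sqr.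
have MtV g : M g -> M (tV * g).
  move=> [P [Q ->]]; exists (2%:R * 'X * P + Q), (- P).
  rewrite rmorphN rmorphD !rmorphM rmorph_nat /= horner_algX tVE.
  ring: tpow_sqr.
have M1 : M 1 by exists 1, 0; rewrite rmorph1 rmorph0 mul0r addr0.
have Mpow n : M (tpow F n).
  case: n => n.
    elim: n => [//|n IH].
    by have -> : tpow F n.+1 = t * tpow F n; [rewrite tpowD -PoszD|apply: Mt].
  rewrite NegzE; elim: n => [|n IH]; first by rewrite -[tV]mulr1; apply: MtV.
  have -> : tpow F (- n.+2%:Z) = tV * tpow F (- n.+1%:Z).
    by rewrite tpowD -opprD -PoszD.
  exact: MtV.
change (M f); rewrite (laurent_tpowE f).
apply: (big_ind M) => [|_ _ [P [Q ->]] [P' [Q' ->]]|n _].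
- by exists 0, 0; rewrite !rmorph0 mul0r addr0.
- by exists (P + P'), (Q + Q'); rewrite !rmorphD /=; ring.
have [P [Q ->]] := Mpow n; exists (mcoeff n f *: P), (mcoeff n f *: Q).
by rewrite !linearZ /= scalerDr !mulr_algl scalerAl.
Qed.

(** The square of t - t^-1 is a nonzero element of F[s], over which the Laurent
    polynomials are free. *)
Lemma tpowB_cancel (f : laurent F) : (t - tV) * f = 0 -> f = 0.
Proof.
have [P [Q ->]] := laurent_decomp f => tf0.
set D : {poly F} := 4%:R * ('X^2 - 1).
have /laurent_free[DP0 DQ0] : (D * P).[s] + (D * Q).[s] * t = 0.
  rewrite [(D * P).[s]]rmorphM [(D * Q).[s]]rmorphM /= -tpowB_sqr.
  have -> : (t - tV) ^+ 2 * P.[s] + (t - tV) ^+ 2 * Q.[s] * t =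
    (t - tV) * ((t - tV) * (P.[s] + Q.[s] * t)) by ring.
  by rewrite tf0 mulr0.
rewrite (mulfI tpowB_sqr_neq0 (etrans DP0 (esym (mulr0 D)))).
rewrite (mulfI tpowB_sqr_neq0 (etrans DQ0 (esym (mulr0 D)))).
by rewrite rmorph0 mul0r addr0.
Qed.

Lemma linv_eq (f : laurent F) : linv f = f -> exists P, f = P.[s].
Proof.
have [P [Q ->]] := laurent_decomp f.
rewrite rmorphD rmorphM /= !linv_horner linv_tpow => /eqP.
rewrite -subr_eq0 => /eqP sym.
have Q0 : Q.[s] = 0.
  by apply: tpowB_cancel; rewrite -[RHS]oppr0 -sym; ring.
by exists P; rewrite Q0 mul0r addr0.
Qed.

(** An antisymmetric P(s) + Q(s) t satisfies P = - s Q, and t - s is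
    (t - t^-1)/2. *)
Lemma linv_eqN (f : laurent F) :
  linv f = - f -> exists P, f = P.[s] * (tV - t).
Proof.
have [P [Q ->]] := laurent_decomp f.
rewrite rmorphD rmorphM /= !linv_horner linv_tpow tVE => /eqP.
rewrite -subr_eq0 => /eqP antisym.
have /laurent_free[/eqP] :
    (2%:R * (P + 'X * Q)).[s] + (0 : {poly F}).[s] * t = 0.
  rewrite rmorph0 rmorphM rmorph_nat rmorphD rmorphM /= horner_algX -[RHS]antisym.
  ring.
rewrite mulf_eq0 -polyC_natr polyC_eq0 (negPf two_neq0) /=.
rewrite addr_eq0 => /eqP -> _; exists (- (2^-1 *: Q)).
rewrite !rmorphN rmorphM /= horner_algX linearZ /= mulr_algl.
rewrite -{1 2}[Q.[s]]mul2_half; ring.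
Qed.

Lemma lev1_horner (P : {poly F}) : lev1 P.[s] = P.[1].
Proof.
have lev1s : lev1 s = 1.
  by rewrite /tavg linearZ /= raddfD /= !lev1_tpow mulVf.
elim/poly_ind: P => [|P a IH]; first by rewrite !raddf0 horner0.
rewrite !rmorphD !rmorphM /= horner_algX horner_algC lev1s IH.
by rewrite linearZ /= rmorph1 !mulr1 hornerMXaddC mulr1.
Qed.

(** * The Onsager algebra *)

(** The trace-zero matrices fixed by theta: the coordinates P, Q of the (0, 1)
    entry are free, and S is the coordinate of the antisymmetric (0, 0) entry. *)
Definition onsager_map (u : {poly F} * {poly F} * {poly F}) : loop_gl2 F :=
  mat2 (u.2.[s] * (tV - t)) (u.1.1.[s] + u.1.2.[s] * t)
       (u.1.1.[s] + u.1.2.[s] * tV) (u.2.[s] * (t - tV)).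

Fact onsager_map_linear : linear onsager_map.
Proof.
move=> a u v; apply: loopP; rewrite !mxE /= !linearP /= !mulr_algl.
- by rewrite mulrDl scalerAl.
- by rewrite mulrDl scalerDr -scalerAl addrACA.
- by rewrite mulrDl scalerDr -scalerAl addrACA.
- by rewrite mulrDl scalerAl.
Qed.

HB.instance Definition _ :=
  GRing.isLinear.Build F ({poly F} * {poly F} * {poly F})%type (loop_gl2 F) _
    onsager_map onsager_map_linear.

Lemma onsager_map_inj (u : {poly F} * {poly F} * {poly F}) :
  onsager_map u = 0 -> u = 0.
Proof.
case: u => [[P Q] S] u0.
have /laurent_free[-> ->] : P.[s] + Q.[s] * t = 0.
  by have := congr1 (fun x : loop_gl2 F => x 0 1) u0; rewrite !mxE.
have /laurent_free[_ /eqP] : (2 * 'X * S).[s] + (- (2 * S)).[s] * t = 0.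
  have := congr1 (fun x : loop_gl2 F => x 0 0) u0; rewrite !mxE /= => <-.
  rewrite rmorphN !rmorphM rmorph_nat /= horner_algX tVE; ring.
rewrite oppr_eq0 mulf_eq0 -polyC_natr polyC_eq0 (negPf two_neq0) /=.
by move/eqP->.
Qed.

Lemma onsagerP (x : loop_gl2 F) :
  onsager x <-> exists u, x = onsager_map u.
Proof.
split=> [[trx thx]|[[[P Q] S] ->]].
  have th i j : x i j = theta x i j by rewrite thx.
  have d_eqN : x 1 1 = - x 0 0.
    by apply/eqP; rewrite -addr_eq0 addrC -loop_trE; apply/eqP.
  have [S a_eq] : exists S : {poly F}, x 0 0 = S.[s] * (tV - t).
    by apply: linv_eqN; rewrite -d_eqN [RHS]th mat2E.
  have [P [Q b_eq]] := laurent_decomp (x 0 1).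
  exists (P, Q, S); apply: loopP; rewrite mat2E //=.
    by rewrite th mat2E b_eq rmorphD rmorphM /= !linv_horner linv_tpow.
  by rewrite d_eqN a_eq -mulrN opprB.
split; first by rewrite /loop_sl2 loop_trE !mat2E /=; ring.
apply: loopP; rewrite !mat2E /=; rewrite ?rmorphD !rmorphM ?rmorphB /=;
  by rewrite !linv_horner !linv_tpow ?opprK.
Qed.

Lemma onsager_familyE (i : nat + nat + nat) :
  onsager_family F i = onsager_map
    (pair_family (pair_family (fun k => 'X^k) (fun k => 'X^k))
       (fun k => 'X^k) i).
Proof.
have sX k : ('X^k).[s] = s ^+ k by rewrite rmorphXn /= horner_algX.
case: i => [[k|k]|k]; apply: loopP; rewrite !mxE /= ?rmorph0 ?sX; try ring.
- by apply: half_eq; ring.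
- by apply: half_eq; ring.
Qed.

Lemma onsager_basis : is_basis (@onsager F) (@onsager_family F).
Proof.
apply: (is_basis_image _ onsager_map_inj onsagerP onsager_familyE).
by do 2?apply: is_basis_pair; apply: is_basis_monomials.
Qed.

(** * The center *)

(** Multiples of (2 s - 2) I, the member of index 0 of [center_family]. *)
Definition center_map (P : {poly F}) : loop_gl2 F :=
  mat2 (P.[s] * (2 * s - 2)) 0 0 (P.[s] * (2 * s - 2)).

Fact center_map_linear : linear center_map.
Proof.
move=> a P Q; apply: loopP; rewrite !mxE /= ?scaler0 ?addr0 //.
  by rewrite linearP /= mulr_algl mulrDl scalerAl.
by rewrite linearP /= mulr_algl mulrDl scalerAl.
Qed.

HB.instance Definition _ :=
  GRing.isLinear.Build F {poly F} (loop_gl2 F) _ center_map center_map_linear.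

Lemma center_map_inj (P : {poly F}) : center_map P = 0 -> P = 0.
Proof.
move=> P0; have : (P * (2 * ('X - 1%:P))).[s] = 0.
  have := congr1 (fun x : loop_gl2 F => x 0 0) P0; rewrite !mxE /= => <-.
  rewrite !rmorphM rmorph_nat rmorphB rmorph1 /= horner_algX; ring.
move/horner_tavg_inj/eqP; rewrite !mulf_eq0 polyXsubC_eq0 orbF.
by rewrite -polyC_natr polyC_eq0 (negPf two_neq0) orbF => /eqP.
Qed.

Lemma cal_onsager_W_neg0 : cal_onsager (W_neg F 0).
Proof.
apply/onsager_sub/onsagerP; eexists; exact: (onsager_familyE (inl (inl 0%N))).
Qed.

Lemma cal_onsager_W_succ0 : cal_onsager (W_succ F 0).
Proof.
apply/onsager_sub/onsagerP; eexists; exact: (onsager_familyE (inl (inr 0%N))).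
Qed.

(** Commuting with W_0 gives x the rows (a, b) and (b, a); commuting with W_1 as
    well gives b t^-1 = t b, whence b = 0. *)
Lemma commute_W_scalar (x : loop_gl2 F) :
    bracket x (W_neg F 0) = 0 -> bracket x (W_succ F 0) = 0 ->
  [/\ x 0 1 = 0, x 1 0 = 0 & x 1 1 = x 0 0].
Proof.
move=> xW0 xW1.
have e0 i j : (x * W_neg F 0) i j = (W_neg F 0 * x) i j.
  by rewrite (subr0_eq xW0).
have e1 i j : (x * W_succ F 0) i j = (W_succ F 0 * x) i j.
  by rewrite (subr0_eq xW1).
have := e0 0 0; have := e0 0 1; have := e1 0 0.
rewrite !loop_mulE !mxE /= !expr0 !mul1r ?(mulr0, mulr1, mul0r, mul1r).
rewrite ?(add0r, addr0) => b_eq a_eq bc.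
suff b0 : x 0 1 = 0 by rewrite -bc b0.
by apply: tpowB_cancel; rewrite mulrBl -[tV * _]mulrC b_eq bc subrr.
Qed.

(** For x = a I, theta-invariance says a = P(s), and epsilon(x) = 2 P(1), so that
    P is divisible by X - 1. *)
Lemma centerP (x : loop_gl2 F) :
  center_cal_onsager x <-> exists P, x = center_map P.
Proof.
split=> [[[ex thx] cx]|[P ->]].
  have [b0 c0 d_eq] :=
    commute_W_scalar (cx _ cal_onsager_W_neg0) (cx _ cal_onsager_W_succ0).
  have [P a_eq] : exists P : {poly F}, x 0 0 = P.[s].
    by apply: linv_eq; rewrite -[in RHS]thx mat2E d_eq.
  have /factor_theorem[R P_eq] : root P 1.
    move: ex; rewrite /ker_epsilon /epsilon d_eq a_eq lev1_horner => /eqP.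
    by rewrite -mulr2n -mulr_natl mulf_eq0 (negPf two_neq0).
  exists (2^-1 *: R).
  have a_eq' : x 0 0 = (2^-1 *: R).[s] * (2 * s - 2).
    rewrite a_eq P_eq rmorphM rmorphB rmorph1 /= horner_algX.
    rewrite linearZ /= mulr_algl.
    rewrite -{1}[R.[s]]mul2_half; ring.
  by apply: loopP; rewrite mat2E // d_eq.
have fixed : linv (P.[s] * (2 * s - 2)) = P.[s] * (2 * s - 2).
  by rewrite rmorphM rmorphB rmorphM rmorph_nat /= linv_horner linv_tavg.
split=> [|y _].
  split; last by apply: loopP; rewrite !mat2E ?fixed ?rmorph0.
  have lev1s : lev1 s = 1.
    by rewrite -[s](horner_algX s) lev1_horner hornerX.
  rewrite /ker_epsilon /epsilon !mat2E rmorphM rmorphB rmorphM rmorph_nat /=.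
  rewrite lev1s; ring.
by apply: loopP; rewrite /bracket mxE [X in _ + X]mxE !loop_mulE !mat2E mxE; ring.
Qed.

Lemma center_familyE (k : nat) : center_family F k = center_map 'X^k.
Proof.
have sX : ('X^k).[s] = s ^+ k by rewrite rmorphXn /= horner_algX.
apply: loopP; rewrite !mxE /= ?sX.
- by apply: half_eq; rewrite tVE; ring.
- rewrite [X in _ *: X](_ : _ = 0) ?scaler0; ring.
- rewrite [X in _ *: X](_ : _ = 0) ?scaler0; ring.
- by apply: half_eq; rewrite tVE; ring.
Qed.

Lemma center_basis : is_basis (@center_cal_onsager F) (@center_family F).
Proof.
exact: (is_basis_image (is_basis_monomials F) center_map_inj centerP
  center_familyE).
Qed.

End Laurent.

Theorem lemma4p17 (F : fieldType)
    (charF0 : [pchar F]%R =i pred0) :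
  is_basis (@onsager F) (@onsager_family F) /\
  is_basis (@center_cal_onsager F) (@center_family F).
Proof.
have two_neq0 : (2 : F) != 0 by have := charF0 2; rewrite !inE /= => ->.
by split; [apply: onsager_basis | apply: center_basis].
Qed.
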